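(* There exist absolute constants $C$ and $n_0$ such that every group $G$ of order $n\ge n_0$ has a generating set $S$ with $|S|\le C\log n$ such that the Cayley graph $\Gamma(G,S)$ is Hamiltonian.
   Context: For a group $G$ and $S\subseteq G$, the (undirected) Cayley graph $\Gamma(G,S)$ has vertex set $G$ and edge set consisting of all pairs $\{g,gs\}$ with $g\in G$, $s\in S$ and $g\neq gs$. A graph is Hamiltonian if it contains a cycle through all its vertices. *)

(* Defs.v *)
From mathcomp Require Import all_boot all_fingroup.
From Stdlib Require Import Reals.
Set Implicit Arguments. Unset Strict Implicit. Unset Printing Implicit Defensive.
Local Open Scope group_scope.

Definition cayley_adj (gT : finGroupType) (S : {set gT}) : rel gT :=
  fun x y => (x != y) && [exists s in S, (y == x * s) || (x == y * s)].

Definition hamiltonian (T : finType) (e : rel T) : Prop :=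
  exists c : seq T, [/\ perm_eq c (enum T), (3 <= size c)%N & path.cycle e c].

(* Main.v *)
(* View a cycle cover of G by steps in S as a permutation f with
   x^-1 * f x \in S.  Start from a permutation f0 all of whose cycles have length
   at least 3, using at most two steps.  If f agrees with f0 at x and at x * t, and
   these two points lie in different cycles of f, then tperm x (x * t) * f merges
   the two cycles, and its new steps lie in t *: S0 and t^-1 *: S0 whatever x is:
   a single t serves for many merges.  Since each merge spoils only two points and
   the initial cycles have length at least 3, f keeps agreeing with f0 on a third
   of G, so an average t merges a constant fraction of the cycles, and O(log n)
   choices of t leave a single one. *)
Require Import Defs.
From mathcomp Require Import all_boot all_fingroup all_solvable.
From mathcomp Require Import zify.

Set Implicit Arguments.
Unset Strict Implicit.
Unset Printing Implicit Defensive.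
Local Open Scope group_scope.

(** * Cycles of a permutation multiplied by a transposition *)

Section PermutationCycles.

Variable T : finType.
Implicit Types (f g : {perm T}) (x y z : T).

Lemma mem_porbit_perm f x z : (f z \in porbit f x) = (z \in porbit f x).
Proof. by rewrite -!eq_porbit_mem -[in RHS](porbit_perm f 1 z) expg1. Qed.

Lemma eq_in_porbit f g z :
  {in porbit f z, forall u, g u = f u} -> porbit g z = porbit f z.
Proof.
move=> eqfg.
have expE i : (g ^+ i) z = (f ^+ i) z.
  by elim: i => [|i IHi]; rewrite ?perm1 // !expgSr !permM IHi eqfg ?mem_porbit.
by apply/setP => u; apply/porbitP/porbitP => -[i ->]; exists i; rewrite expE.
Qed.

Lemma porbit_subset f x (P : {set T}) :
  x \in P -> {in P, forall z, f z \in P} -> porbit f x \subset P.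
Proof.
move=> Px clP; apply/subsetP => _ /porbitP[i ->].
by elim: i => [|i IHi]; rewrite ?perm1 // expgSr permM clP.
Qed.

Lemma porbits_merge f x y : y \notin porbit f x ->
  #|porbits (tperm x y * f)|.+1 = #|porbits f|.
Proof.
move=> yNx; have := porbits_mul_tperm f x y.
have -> : x != y by apply: contraNneq yNx => <-; apply: porbit_id.
rewrite porbit_sym yNx /=; lia.
Qed.

Lemma porbit_merge f x y : y \notin porbit f x ->
  porbit (tperm x y * f) x = porbit f x :|: porbit f y.
Proof.
move=> yNx; set g := tperm x y * f.
have neq_xy : x != y by apply: contraNneq yNx => <-; apply: porbit_id.
(* Multiplying [g] by the same transposition gives back [f], which has one cycle more; a
   transposition splits a cycle only when both its points lie in it. *)
have xy_g : x \in porbit g y.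
  have := porbits_mul_tperm g x y.
  rewrite /g mulgA tperm2 mul1g -/g neq_xy -(porbits_merge yNx) -/g.
  by case: (x \in _) => //=; lia.
apply/eqP; rewrite eqEsubset subUset; apply/and3P; split.
- apply: porbit_subset => [|z]; first by rewrite !inE porbit_id.
  rewrite !inE permM !mem_porbit_perm.
  by case: tpermP => [->|->|]; rewrite ?porbit_id ?orbT.
- apply: porbit_subset => [|z]; first exact: porbit_id.
  have -> : f z = g (tperm x y z) by rewrite permM tpermK.
  rewrite mem_porbit_perm; case: tpermP => // -> _; last exact: porbit_id.
  by rewrite porbit_sym.
- apply: porbit_subset => [|z]; first by rewrite porbit_sym.
  have -> : f z = g (tperm x y z) by rewrite permM tpermK.
  rewrite mem_porbit_perm; case: tpermP => // -> _; last exact: porbit_id.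
  by rewrite porbit_sym.
Qed.

Lemma porbit_unmerged f x y z : z \notin porbit f x -> z \notin porbit f y ->
  porbit (tperm x y * f) z = porbit f z.
Proof.
move=> zNx zNy; apply: eq_in_porbit => u; rewrite permM -eq_porbit_mem => /eqP uz.
rewrite tpermD //; [apply: contraNneq zNx | apply: contraNneq zNy] => ->;
  by rewrite -eq_porbit_mem uz.
Qed.

Lemma card_sum_mem (A : {set T}) : #|A| = \sum_x (x \in A).
Proof. by rewrite -sum1_card big_mkcond; apply: eq_bigr => x _; case: (x \in A). Qed.

Lemma sum_porbits f (B : {set T}) :
  \sum_(C in porbits f) #|C :&: B| = #|B|.
Proof.
under eq_bigr => C _ do rewrite card_sum_mem.
rewrite exchange_big card_sum_mem /=; apply: eq_bigr => x _.
rewrite (bigD1 (porbit f x)) ?imset_f // in_setI porbit_id /= big1 ?addn0 //.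
move=> _ /andP[/imsetP[y _ ->]].
by rewrite eq_sym eq_porbit_mem in_setI => /negPf->.
Qed.

Lemma card_porbit_ge3 f x : f x != x -> f (f x) != x -> 2 < #|porbit f x|.
Proof.
move=> f1 f2; have : uniq [:: x; f x; f (f x)].
  by rewrite /= !inE (inj_eq perm_inj) negb_or ![x == _]eq_sym f1 f2.
move/card_uniqP => /= <-; apply: subset_leq_card; apply/subsetP => z.
by rewrite !inE => /or3P[]/eqP->; rewrite ?mem_porbit_perm porbit_id.
Qed.

End PermutationCycles.

(** * Merging cycles along right translations *)

Section Merging.

Variables (gT : finGroupType) (f0 : {perm gT}) (S0 : {set gT}).
Hypothesis f0_step : forall x, x^-1 * f0 x \in S0.
Implicit Types (f : {perm gT}) (S : {set gT}).

Definition unswitched f := [set x | f x == f0 x].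

(* Preserved by a merge, which adds up two orbits and spoils at most two
   points: 3 (c + c' + 2) + 6 = (3 c + 6) + (3 c' + 6). *)
Definition mostly_unswitched f :=
  forall x, 3 * #|porbit f x :\: unswitched f| + 6 <= 2 * #|porbit f x|.

(** Nothing is switched yet, and every cycle has length at least 3, so the slack 6 is covered by 2 *
    3. *)
Lemma mostly_unswitched_base :
  (forall x, f0 x != x) -> (forall x, f0 (f0 x) != x) -> mostly_unswitched f0.
Proof.
move=> f1 f2 x; have := card_porbit_ge3 (f1 x) (f2 x).
suff -> : porbit f0 x :\: unswitched f0 = set0 by rewrite cards0; lia.
by apply/setP => z; rewrite !inE eqxx.
Qed.

Lemma mostly_unswitched_merge f x y : y \notin porbit f x ->
  mostly_unswitched f -> mostly_unswitched (tperm x y * f).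
Proof.
move=> yNx If z; set g := tperm x y * f.
have AE u : u != x -> u != y -> (u \in unswitched g) = (u \in unswitched f).
  by move=> ux uy; rewrite !inE permM tpermD // eq_sym.
have [zO|] := boolP (z \in porbit f x :|: porbit f y); last first.
  rewrite inE negb_or => /andP[zNx zNy]; rewrite porbit_unmerged //.
  suff -> : porbit f z :\: unswitched g = porbit f z :\: unswitched f by [].
  apply/setP => u; rewrite !in_setD andbC [RHS]andbC.
  case: (boolP (u \in porbit f z)) => // uz; rewrite AE //.
    by apply: contraNneq zNx => <-; rewrite porbit_sym.
  by apply: contraNneq zNy => <-; rewrite porbit_sym.
have -> : porbit g z = porbit f x :|: porbit f y.
  by move: zO; rewrite -porbit_merge // -eq_porbit_mem => /eqP.
have disj : porbit f x :&: porbit f y = set0.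
  apply/setP => u; rewrite in_setI in_set0; apply/negP => /andP[].
  rewrite -!eq_porbit_mem => /eqP-> xy.
  by move: yNx; rewrite porbit_sym -eq_porbit_mem xy.
have -> : #|porbit f x :|: porbit f y| = (#|porbit f x| + #|porbit f y|)%N.
  by rewrite cardsU disj cards0 subn0.
have : #|(porbit f x :|: porbit f y) :\: unswitched g| <=
       #|porbit f x :\: unswitched f| + #|porbit f y :\: unswitched f| + 2.
  have sub : (porbit f x :|: porbit f y) :\: unswitched g \subset
      (porbit f x :\: unswitched f) :|: (porbit f y :\: unswitched f) :|: [set x; y].
    apply/subsetP => u; rewrite !in_setU !in_setD !in_set1 in_setU.
    have [|ux] := eqVneq u x; first by rewrite !orbT.
    have [|uy] := eqVneq u y; first by rewrite !orbT.
    by rewrite AE // => /andP[-> ->].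
  apply: leq_trans (subset_leq_card sub) _.
  apply: leq_trans (leq_card_setU _ _) _.
  apply: leq_add; first exact: leq_card_setU.
  by rewrite cards2; case: eqP.
have := If x; have := If y; lia.
Qed.

Lemma card_unswitched f : mostly_unswitched f -> #|gT| <= 3 * #|unswitched f|.
Proof.
move=> If.
have : 3 * #|~: unswitched f| <= 2 * #|[set: gT]|.
  rewrite -(sum_porbits f (~: _)) -(sum_porbits f setT) !big_distrr /=.
  apply: leq_sum => _ /imsetP[x _ ->]; rewrite setIT -setDE.
  exact: leq_trans (leq_addr _ _) (If x).
by rewrite cardsT -(cardsC (unswitched f)); lia.
Qed.

Lemma unswitched_in_porbit f x :
  mostly_unswitched f -> exists2 y, y \in porbit f x & y \in unswitched f.
Proof.
move=> If; have /set0Pn[y] : porbit f x :&: unswitched f != set0.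
  apply/eqP => E; have := If x.
  have := cardsID (unswitched f) (porbit f x); rewrite E cards0; lia.
by rewrite in_setI => /andP[]; exists y.
Qed.

(** The merge sends [x] to [f0 (x * t)] and [x * t] to [f0 x]. These steps are [t] and [t^-1] times
    the [f0]-steps at [x * t] and at [x]. *)
Lemma step_merge f S t x :
    t *: S0 \subset S -> t^-1 *: S0 \subset S ->
    x \in unswitched f -> x * t \in unswitched f ->
  (forall z, z^-1 * f z \in S) ->
  forall z, z^-1 * (tperm x (x * t) * f) z \in S.
Proof.
move=> /subsetP tS /subsetP tVS; rewrite !inE => /eqP fx /eqP fxt fS z.
rewrite permM; case: tpermP => [->|->|_ _]; last exact: fS.
- apply: tS; rewrite mem_lcoset fxt.
  by have := f0_step (x * t); rewrite invMg mulgA.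
- apply: tVS; rewrite mem_lcoset fx invMg invgK.
  by rewrite !mulgA mulgV mul1g; apply: f0_step.
Qed.

(* Merging at one point of [X] spoils at most two others: the one lying in the
   cycle of [x * t], and the one sent to [x] by [t]. *)
Lemma merge_many f S t (X : {set gT}) :
    t *: S0 \subset S -> t^-1 *: S0 \subset S ->
    {in X, forall x, [/\ x \in unswitched f, x * t \in unswitched f
                       & x * t \notin porbit f x]} ->
    {in X &, forall x y, x \in porbit f y -> x = y} ->
    (forall z, z^-1 * f z \in S) -> mostly_unswitched f ->
  exists g : {perm gT}, [/\ forall z, z^-1 * g z \in S, mostly_unswitched g
              & #|X| + 3 * #|porbits g| <= 3 * #|porbits f|].
Proof.
move=> tS tVS; have [m] := ubnP #|X|.
elim: m => // m IHm in f X * => leXm Xgood Xinj fS If.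
have [->|[x xX]] := set_0Vmem X; first by exists f; rewrite cards0.
have [Ax Axt xtNx] := Xgood x xX.
pose g := tperm x (x * t) * f.
pose bad := [set y in X | y \in porbit f (x * t)].
(* One merge uses up at most three points of [X], hence the factor 3 in the conclusion. *)
pose Y := X :\ x :\ (x * t^-1) :\: bad.
have le_bad : #|bad| <= 1.
  apply/card_le1P => y; rewrite inE => /andP[yX yb] z.
  rewrite !inE; apply/andP/eqP => [[zX zb]|->//].
  by apply: Xinj => //; move: zb yb; rewrite -!eq_porbit_mem => /eqP-> /eqP->.
have le_D1 (B : {set gT}) a : #|B| <= #|B :\ a| + 1.
  by rewrite (cardsD1 a B); case: (a \in B) => /=; lia.
have card_X : #|X| <= #|Y| + 3.
  have := le_D1 X x; have := le_D1 (X :\ x) (x * t^-1).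
  have := cardsID bad (X :\ x :\ (x * t^-1)); rewrite -/Y.
  have := leq_trans (subset_leq_card (subsetIr (X :\ x :\ (x * t^-1)) bad)) le_bad.
  have ar (a b c d e : nat) :
    a <= 1 -> (a + e)%N = b -> c <= b + 1 -> d <= c + 1 -> d <= e + 3 by lia.
  exact: ar.
have Y_lt : #|Y| < #|X|.
  rewrite (cardsD1 x X) xX ltnS; apply: subset_leq_card.
  by apply/subsetP => z; rewrite !inE => /and3P[_ _ ->].
have YP y : y \in Y ->
    [/\ y \in X, y \notin porbit f x, y \notin porbit f (x * t) & y * t != x].
  rewrite !in_setD !in_set1 inE negb_and => /and4P[Hb yt ynx yX].
  move: Hb; rewrite yX /= => Hb; split => //.
    by apply: contraNN ynx => /Xinj-> //.
  by apply: contraNneq yt => <-; rewrite mulgK.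
have porbY y : y \in Y -> porbit g y = porbit f y.
  by case/YP => _ yx yxt _; apply: porbit_unmerged.
have AY z : z != x -> z != x * t -> z \in unswitched f -> z \in unswitched g.
  by move=> zx zxt; rewrite !inE permM tpermD // eq_sym.
have gS := step_merge tS tVS Ax Axt fS.
have [|||h [hS Ih leh]] := IHm g Y _ _ _ gS (mostly_unswitched_merge xtNx If).
- exact: leq_trans Y_lt _.
- move=> y yY; have [yX yx yxt ytx] := YP y yY.
  have [Ay Ayt ytNy] := Xgood y yX; split; last by rewrite porbY.
    by apply: AY => //; [apply: contraNneq yx | apply: contraNneq yxt] => ->;
      apply: porbit_id.
  apply: AY => //; rewrite (can_eq (mulgK t)).
  by apply: contraNneq yx => ->; apply: porbit_id.
- move=> y z yY zY; rewrite porbY // => yz.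
  by have [yX _ _ _] := YP y yY; have [zX _ _ _] := YP z zY; apply: Xinj.
exists h; split=> //.
have ar (a b c d e : nat) :
  a <= b + 3 -> d.+1 = e -> b + 3 * c <= 3 * d -> a + 3 * c <= 3 * e by lia.
exact: ar card_X (porbits_merge xtNx) leh.
Qed.

(* Averaging over [t]: with one unswitched representative [r C] per cycle [C],
   the pairs [(C, t)] such that [r C * t] is unswitched and outside [C] number
   exactly [(k - 1) * #|unswitched f|]. *)
Lemma good_shift f : mostly_unswitched f ->
  exists t (X : {set gT}),
    [/\ {in X, forall x, [/\ x \in unswitched f, x * t \in unswitched f
                           & x * t \notin porbit f x]},
        {in X &, forall x y, x \in porbit f y -> x = y}
      & #|porbits f| <= 3 * #|X| + 1].
Proof.
move=> If; set A := unswitched f.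
(* The default 1 is never reached on a cycle of [f], since each contains an unswitched point. *)
pose r (C : {set gT}) := odflt 1 [pick y in C :&: A].
have rP C : C \in porbits f -> [/\ r C \in A & porbit f (r C) = C].
  case/imsetP => x _ ->; rewrite /r; case: pickP => [y|no] /=.
    by rewrite in_setI -eq_porbit_mem => /andP[/eqP-> ->].
  have [y yx yA] := unswitched_in_porbit x If.
  by have := no y; rewrite in_setI yx yA.
pose P t := [set C in porbits f | r C * t \in A :\: C].
have card_r t : #|r @: P t| = #|P t|.
  apply: card_in_imset => C D; rewrite !inE => /andP[/rP[_ EC] _] /andP[/rP[_ ED] _] E.
  by rewrite -EC E ED.
have sumP : \sum_t #|P t| = (#|porbits f|.-1 * #|A|)%N.
  have -> : \sum_t #|P t| = \sum_(C in porbits f) #|A :\: C|.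
    under eq_bigr => t _ do rewrite card_sum_mem.
    rewrite exchange_big [RHS]big_mkcond /=; apply: eq_bigr => C _.
    case: ifP => HC; last by apply: big1 => t _; rewrite inE HC.
    rewrite card_sum_mem [RHS](reindex_inj (mulgI (r C))).
    by apply: eq_bigr => t _; rewrite inE HC.
  have : \sum_(C in porbits f) (#|A :\: C| + #|C :&: A|) = (#|porbits f| * #|A|)%N.
    rewrite -sum_nat_const; apply: eq_bigr => C _.
    by rewrite addnC setIC cardsID.
  rewrite big_split /= sum_porbits.
  have ar (s a k : nat) : (s + a = k * a -> s = k.-1 * a)%N by case: k; lia.
  exact: ar.
have [/existsP[t le_t]|none] := boolP [exists t, #|porbits f| <= 3 * #|P t| + 1].
  exists t, (r @: P t); rewrite card_r; split=> //.
    move=> x /imsetP[C]; rewrite inE => /andP[/rP[rA rC] /setDP[rtA rtC]] ->.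
    by rewrite rC.
  move=> _ _ /imsetP[C PC ->] /imsetP[D PD ->].
  move: PC PD; rewrite !inE => /andP[/rP[_ EC] _] /andP[/rP[_ ED] _].
  by rewrite -eq_porbit_mem EC ED => /eqP->.
(* If every [t] failed, then with n the order of the group and k the number of cycles, summing over
   [t] would give 3 (k - 1) |A| + 2 n <= k n. But n <= 3 |A| makes the left side at least (k + 1)
   n. *)
have lt_t t : 3 * #|P t| + 1 < #|porbits f|.
  by rewrite ltnNge; apply: contraNN none => le_t; apply/existsP; exists t.
have : \sum_(t : gT) (3 * #|P t| + 2) <= \sum_(t : gT) #|porbits f|.
  by apply: leq_sum => t _; have := lt_t t; lia.
rewrite big_split -big_distrr /= sumP !sum_nat_const cardT -cardE.
have ar (n k a : nat) :
  0 < n -> 1 < k -> n <= 3 * a -> n * k < 3 * (k.-1 * a) + n * 2 by nia.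
rewrite leqNgt ar ?card_unswitched //; last by apply: leq_ltn_trans (lt_t 1); lia.
by apply/card_gt0P; exists 1.
Qed.

(** For k cycles before and k' after, k <= 3 |X| + 1 and |X| + 3 k' <= 3 k give 9 k' <= 9 k - 3 |X|
    <= 8 k + 1, that is, 9 (k' - 1) <= 8 (k - 1). *)
Lemma merge_round f S :
    (forall z, z^-1 * f z \in S) -> mostly_unswitched f ->
  exists (g : {perm gT}) (S' : {set gT}), [/\ forall z, z^-1 * g z \in S', mostly_unswitched g,
                   #|S'| <= #|S| + 2 * #|S0|
                 & 9 * #|porbits g| <= 8 * #|porbits f| + 1].
Proof.
move=> fS If; have [t [X [Xgood Xinj leX]]] := good_shift If.
pose S' := S :|: (t *: S0 :|: t^-1 *: S0).
have [|||g [gS Ig leg]] := @merge_many f S' t X _ _ Xgood Xinj _ If.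
- by rewrite /S' setUCA subsetUl.
- by rewrite /S' setUA subsetUr.
- by move=> z; rewrite inE fS.
exists g, S'; split=> //; last by lia.
apply: leq_trans (leq_card_setU _ _) _; rewrite leq_add2l.
by apply: leq_trans (leq_card_setU _ _) _; rewrite !card_lcoset; lia.
Qed.

(** The number of cycles minus one shrinks by a factor 8/9 per round; being an integer, it vanishes
    once it is below 1. *)
Lemma merge_rounds m f S :
    (forall z, z^-1 * f z \in S) -> mostly_unswitched f ->
    8 ^ m * #|porbits f|.-1 < 9 ^ m ->
  exists (g : {perm gT}) (S' : {set gT}), [/\ forall z, z^-1 * g z \in S',
                   #|S'| <= #|S| + m * (2 * #|S0|) & #|porbits g| <= 1].
Proof.
elim: m f S => [|m IHm] f S fS If.
  by rewrite mul1n => lek; exists f, S; split=> //; lia.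
rewrite !expnS => lek.
have [g [S1 [gS Ig leS1 leg]]] := merge_round fS If.
have [|h [S2 [hS leS2 leh]]] := IHm g S1 gS Ig; last by exists h, S2; split=> //; lia.
have : 9 * #|porbits g|.-1 <= 8 * #|porbits f|.-1 by lia.
by nia.
Qed.

End Merging.

(** * The initial permutation without short cycles *)

(* Right translation by an element of order at least 3 works.  In an elementary
   abelian 2-group with a subgroup M of index 2, alternate between two distinct
   steps outside M, which gives 4-cycles. *)
Lemma exists_base_permutation (gT : finGroupType) : 2 < #|gT| ->
  exists (f : {perm gT}) (S : {set gT}),
    [/\ #|S| <= 2, forall x, x^-1 * f x \in S, forall x, f x != x
      & forall x, f (f x) != x].
Proof.
move=> gT3.
have [/existsP[a a2]|none] := boolP [exists a : gT, a ^+ 2 != 1].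
  exists (perm (mulIg a)), [set a]; split=> [|x|x|x]; rewrite ?cards1 ?permE //.
  - by rewrite mulKg set11.
  - apply: contraNneq a2 => E; have -> : a = 1 by apply: (mulgI x); rewrite E mulg1.
    by rewrite expg1n.
  - apply: contraNneq a2 => E; rewrite expgS expg1; apply/eqP.
    by apply: (mulgI x); rewrite mulgA mulg1.
have sq1 (a : gT) : a * a = 1.
  by apply/eqP; apply: contraNT none => a2; apply/existsP; exists a; rewrite expgS expg1.
have pG : 2.-group [set: gT].
  apply/pgroupP => q q_pr /(Cauchy q_pr)[x _ ox].
  have : #[x] %| 2 by rewrite order_dvdn expgS expg1 sq1.
  by rewrite ox dvdn_prime2 // => /eqP->.
have [eq1|[M maxM _]] := maximal_exists (sub1G [set: gT]).
  by move: gT3; rewrite -cardsT -eq1 cards1.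
have nM : 'N(M) = [set: gT].
  by apply/eqP; rewrite eqEsubset subsetT normal_norm // (p_maximal_normal pG).
have iM : #|[set: gT] : M| = 2 := p_maximal_index pG maxM.
have oM : (#|M| * 2)%N = #|gT| by rewrite -iM Lagrange ?subsetT ?cardsT.
have /properP[_ [p _ pNM]] := maxgroupp maxM.
have [m mM m1] : exists2 m, m \in M & m != 1.
  by apply/trivgPn; rewrite -cardG_gt1; lia.
have comm (x y : gT) : x * y = y * x.
  by apply: (mulgI (x * y)); rewrite sq1 -mulgA (mulgA y) sq1 mul1g sq1.
have MP x q : q \notin M -> (x * q \in M) = (x \notin M).
  move=> qNM; have [xM|xNM] := boolP (x \in M); first by rewrite groupMl // (negPf qNM).
  have := rcoset_index2 (subsetT M) iM; move/(_ x^-1).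
  rewrite !inE groupV xNM => /(_ isT)/setP/(_ q).
  by rewrite !inE qNM mem_rcoset invgK comm.
have pmNM : p * m \notin M by rewrite groupMr.
(* [F] exchanges [M] and its complement, so it has no fixed point; applied twice it multiplies by
   [m], which is not 1. *)
pose F x := if x \in M then x * p else x * (p * m).
have FM x : (F x \in M) = (x \notin M) by rewrite /F; case: ifP => xM; rewrite MP ?xM.
have F_inj : injective F.
  move=> x y E; have := FM x; rewrite E FM => /negb_inj xy.
  by move: E; rewrite /F xy; case: ifP => _ /mulIg.
exists (perm F_inj), [set p; p * m]; split=> [|x|x|x]; rewrite ?permE.
- by rewrite cards2; case: eqP.
- by rewrite /F; case: ifP => _; rewrite mulKg !inE eqxx ?orbT.
- by apply/eqP => E; have := FM x; rewrite E; case: (x \in M).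
- rewrite {1}/F FM /F; case: (x \in M); apply: contraNneq m1 => E.
    by apply/eqP/(mulgI x); rewrite mulg1 -[RHS]E -!mulgA (mulgA p) sq1 mul1g.
  by apply/eqP/(mulgI x); rewrite mulg1 -[RHS]E -!mulgA (comm m) (mulgA p) sq1 mul1g.
Qed.

(** * From a single cycle to the logarithmic bound *)

Lemma single_cycle_hamiltonian (gT : finGroupType) (f : {perm gT}) (S : {set gT}) :
    2 < #|gT| -> (forall x, x^-1 * f x \in S) -> #|porbits f| <= 1 ->
  <<S>> = [set: gT] /\ hamiltonian (cayley_adj S).
Proof.
move=> gT3 fS le1.
have orb x : porbit f x = [set: gT].
  apply/setP => y; rewrite in_setT -eq_porbit_mem.
  by apply/eqP; apply: (card_le1_eqP le1); apply: imset_f.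
have iter1 x : exists i, x = iter i f 1.
  have /porbitP[i ->] : x \in porbit f 1 by rewrite orb inE.
  by exists i; rewrite permX.
split.
  apply/eqP; rewrite eqEsubset subsetT; apply/subsetP => x _.
  have [i ->] := iter1 x; elim: i => [|i IHi]; first exact: group1.
  rewrite iterS; set y := iter i f 1 in IHi *.
  by rewrite -[f y](mulKVg y) groupM // mem_gen.
exists (fingraph.orbit f 1).
have mem_o x : x \in fingraph.orbit f 1.
  by have [i ->] := iter1 x; rewrite -fconnect_orbit fconnect_iter.
have perm_o : perm_eq (fingraph.orbit f 1) (enum gT).
  apply: uniq_perm; rewrite ?orbit_uniq ?enum_uniq // => x.
  by rewrite mem_o mem_enum.
split=> //; first by rewrite (perm_size perm_o) -cardE.
apply: sub_cycle (cycle_orbit (@perm_inj _ f) 1) => x _ /eqP <-.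
rewrite /cayley_adj; apply/andP; split.
  (* A fixed point would be a whole cycle, hence the whole group. *)
  apply: contraTneq gT3 => fx; rewrite -leqNgt -cardsT -(orb x).
  apply: leq_trans (_ : #|[set x]| <= 2); last by rewrite cards1.
  apply/subset_leq_card/porbit_subset => [|z]; rewrite ?set11 //.
  by rewrite inE => /eqP->; rewrite -fx set11.
by apply/existsP; exists (x^-1 * f x); rewrite fS mulKVg eqxx.
Qed.

Lemma exists_small_hamiltonian_set (gT : finGroupType) : 2 < #|gT| ->
  exists S : {set gT},
    [/\ #|S| <= 50 * trunc_log 2 #|gT|, <<S>> = [set: gT]
      & hamiltonian (cayley_adj S)].
Proof.
move=> gT3; have [f0 [S0 [leS0 f0S f0_1 f0_2]]] := exists_base_permutation gT3.
(* Six rounds at least halve the excess of cycles, as 2 * 8^6 <= 9^6, and fewer than 2^(L+1) cycles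
   are present at the start. *)
set L := trunc_log 2 #|gT|.
have [|f [S [fS leS le1]]] :=
    @merge_rounds gT f0 S0 f0S (6 * L.+1) f0 S0 f0S (mostly_unswitched_base f0_1 f0_2).
  have lek : #|porbits f0| < 2 ^ L.+1.
    apply: leq_ltn_trans (_ : #|gT| < _); last exact: trunc_log_ltn.
    by rewrite -cardsT; apply: leq_trans (leq_imset_card _ _) _; rewrite cardsT.
  have ar : 8 ^ 6 * 2 <= 9 ^ 6 by rewrite !expnS !expn0; lia.
  have ltX (a b l k : nat) : 0 < a -> a * 2 <= b -> 0 < l -> k < 2 ^ l -> a ^ l * k < b ^ l.
    move=> a0 leb l0 ltk; apply: leq_trans (_ : (a * 2) ^ l <= _); last by rewrite leq_exp2r.
    by rewrite expnMn ltn_pmul2l // expn_gt0 a0.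
  rewrite (expnM 8) (expnM 9); apply: ltX ar _ _; rewrite ?expn_gt0 //.
  exact: leq_ltn_trans (leq_pred _) lek.
have [genS hamS] := single_cycle_hamiltonian gT3 fS le1.
(* With [#|S0| <= 2] the bound is 2 + 24 (L + 1), which is at most 50 L because L >= 1. *)
exists S; split=> //; apply: leq_trans leS _.
have : 0 < L by rewrite trunc_log_gt0 /= -ltnS ltnW.
by nia.
Qed.

From Stdlib Require Import Reals Lra.

Lemma trunc_log_le_ln (n : nat) : (0 < n)%N ->
  (INR (trunc_log 2 n) * ln 2 <= ln (INR n))%R.
Proof.
move=> n0; rewrite -ln_pow; last by lra.
have E m : INR (expn 2 m) = (2 ^ m)%R.
  by elim: m => [|m IHm] //; rewrite expnS mult_INR IHm.
have pow_gt0 : (0 < 2 ^ trunc_log 2 n)%R by apply: pow_lt; lra.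
have /Rle_lt_or_eq_dec[lt_n|->] : (2 ^ trunc_log 2 n <= INR n)%R.
- by rewrite -E; apply/le_INR/leP/trunc_logP.
- exact/Rlt_le/ln_increasing.
- exact: Rle_refl.
Qed.

Theorem theorem8p7 :
  exists (C : R) (n0 : nat),
    forall gT : finGroupType, (n0 <= #|gT|)%N ->
      exists S : {set gT},
        [/\ <<S>>%g = [set: gT],
            (INR #|S| <= C * ln (INR #|gT|))%R
          & hamiltonian (cayley_adj S)].
Proof.
(* Dividing by [ln 2] converts the base-2 logarithm; a cycle needs at least 3 vertices. *)
exists (50 / ln 2)%R, 3 => gT gT3.
have [S [leS genS hamS]] := exists_small_hamiltonian_set gT3.
exists S; split=> //.
have ln2 : (0 < ln 2)%R by rewrite -ln_1; apply: ln_increasing; lra.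
have := @trunc_log_le_ln #|gT| (ltnW (ltnW gT3)).
have /leP/le_INR := leS; rewrite mult_INR (_ : INR 50 = 50%R); last by rewrite INR_IZR_INZ.
move=> le50 leln; apply: Rle_trans le50 _.
apply: (Rmult_le_reg_r (ln 2)) => //.
rewrite Rmult_assoc; have -> : (50 / ln 2 * ln (INR #|gT|) * ln 2 = 50 * ln (INR #|gT|))%R.
  by field; lra.
by lra.
Qed.
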